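(* Let $V$ be one of the three GAN objectives $V_c$ (classic GAN), $V_w$ (Wasserstein GAN with transport cost $c$) or $V_f$ ($f$-GAN), and let $DIV(P_{\theta_g}\|P_r)$ denote $JSD(P_{\theta_g}\|P_r)$ if $V=V_c$, $W_c(P_{\theta_g}\|P_r)$ if $V=V_w$, and $D_f(P_{\theta_g}\|P_r)$ if $V=V_f$. If $(\theta_d^*,\theta_g^* )$ is a $\lambda$-proximal equilibrium of the GAN game (for some $\lambda\ge0$), then the generator attains the minimum possible divergence with the real data distribution: $$DIV(P_{\theta_g^*}\|P_r)=\min_{\theta_g\in\Theta_G}DIV(P_{\theta_g}\|P_r).$$
   Context: A GAN game is $\min_{\theta_g\in\Theta_G}\max_{\theta_d\in\Theta_D}V(D_{\theta_d},G_{\theta_g})$, where $\theta_d$ parametrizes a discriminator $D_{\theta_d}$ (a function on the data space) and $\theta_g$ parametrizes a generator $G_{\theta_g}$ inducing a distribution $P_{\theta_g}$ on the data space. $P_r$ is the real data distribution. $P_r$ and all $P_{\theta_g}$ have densities with respect to a common measure $dx$, denoted by the same symbols. Objectives, for a discriminator $D$: - Classic GAN: $V_c=\frac12\mathbb{E}_{x\sim P_r}[\log D(x)]+\frac12\mathbb{E}_{x\sim P_{\theta_g}}[\log(1-D(x))]$; admissible discriminators are measurable functions with values in $[0,1]$. - Wasserstein GAN: $V_w=\mathbb{E}_{x\sim P_r}[D(x)]-\mathbb{E}_{x\sim P_{\theta_g}}[D^c(x)]$, where $c(x,y)\ge 0$ is a transport cost with $c(x,x)=0$ and $D^c(x)=\sup_y\{D(y)-c(x,y)\}$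 is the $c$-transform; admissible discriminators are the $c$-concave functions, i.e. $D(y)=\inf_x\{\varphi(x)+c(x,y)\}$ for some function $\varphi$. - $f$-GAN: $V_f=\mathbb{E}_{x\sim P_r}[D(x)]-\mathbb{E}_{x\sim P_{\theta_g}}[f^*(D(x))]$, where $f:\mathbb{R}_+\to\mathbb{R}$ is convex and lower semi-continuous with $f(1)=0$, and $f^*(x)=\sup_{t\in\mathrm{Dom}(f)}\{xt-f(t)\}$ is its Fenchel conjugate; admissible discriminators are measurable functions with values in the domain of $f^*$. Divergences: $JSD$ is the Jensen–Shannon divergence, $JSD(P\|Q)=\frac12 KL(P\|\frac{P+Q}{2})+\frac12 KL(Q\|\frac{P+Q}{2})$; $W_c(P_{\theta_g}\|P_r)=\sup_{D\ c\text{-concave}}\mathbb{E}_{x\sim P_r}[D(x)]-\mathbb{E}_{x\sim P_{\theta_g}}[D^c(x)]$; $D_f(P\|Q)=\int p(x)f\left(\frac{q(x)}{p(x)}\right)dx$. Let $\|\cdot\|$ be a fixed norm (or seminorm) on discriminators. A configuration $(\theta_d^*,\theta_g^* )$ is a $\lambda$-proximal equilibrium if for all $\theta_d\in\Theta_D$, $\theta_g\in\Theta_G$, $$V(D_{\theta_d},G_{\theta_g^*})\le V(D_{\theta_d^*},G_{\theta_g^*})\le\max_{\tilde\theta_d\in\Theta_D}\{V(D_{\tilde\theta_d},G_{\theta_g})-\lambda\|D_{\tilde\theta_d}-D_{\theta_d^*}\|^2\}.$$ Standing assumptions: for each fixed generator $\theta_g$ an optimal discriminator exists, i.e. $\max_{\theta_d\in\Theta_D}V(D_{\theta_d},G_{\theta_g})$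 is attained, is a real number, and equals the supremum of $V$ over all admissible discriminators. All other displayed maxima and minima are assumed to exist. *)

(* Defs.v *)
From HB Require Import structures.
From mathcomp Require Import all_boot all_order all_algebra.
From mathcomp Require Import all_classical all_reals all_analysis measurable_realfun.
Set Implicit Arguments.
Unset Strict Implicit.
Unset Printing Implicit Defensive.
Import Order.TTheory GRing.Theory Num.Theory.
Import numFieldNormedType.Exports.
Local Open Scope classical_set_scope.
Local Open Scope ring_scope.
Local Open Scope ereal_scope.

Definition is_maximum (R : realType) (S : set (\bar R)) (m : \bar R) : Prop :=
  S m /\ ubound S m.

Definition is_minimum (R : realType) (S : set (\bar R)) (m : \bar R) : Prop :=
  S m /\ lbound S m.

Definition is_density d (X : measurableType d) (R : realType)
    (mu : {measure set X -> \bar R}) (P : probability X R) (p : X -> R) : Prop :=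
  [/\ measurable_fun setT p,
      forall x, (0 <= p x)%R &
      forall A, measurable A -> P A = \int[mu]_(x in A) (p x)%:E].

(* The integral of [h] exists in [-oo, +oo], i.e., it is not of the
   form oo - oo. *)
Definition expectation_defined d (X : measurableType d) (R : realType)
    (P : probability X R) (h : X -> \bar R) : Prop :=
  measurable_fun setT h /\
  adde_def (\int[P]_x h^\+ x) (- \int[P]_x h^\- x).

(* E_P[u] - E_Q[v] makes sense in [-oo, +oo]. *)
Definition difference_defined d (X : measurableType d) (R : realType)
    (P Q : probability X R) (u v : X -> \bar R) : Prop :=
  [/\ expectation_defined P u, expectation_defined Q v &
      adde_def (\int[P]_x u x) (- \int[Q]_x v x)].

(* Convex lower semicontinuous functions on [0, +oo[ that vanish at 1. Such
   a function is represented by its extension by +oo to the negative reals;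
   convexity and lower semicontinuity of the extension are those of the
   function, as [0, +oo[ is convex and closed. The value +oo is also allowed
   on [0, +oo[, so that functions given on ]0, +oo[ only, such as
   t |-> - ln t, are covered through their limit at 0. *)
Definition f_divergence_generator (R : realType) (f : R -> \bar R) : Prop :=
  [/\ forall t : R, (t < 0)%R -> f t = +oo,
      forall t : R, -oo < f t,
      forall s t a : R, (0 <= a <= 1)%R ->
        f (a * s + (1 - a) * t)%R <= a%:E * f s + (1 - a)%:E * f t,
      lower_semicontinuous f &
      f 1%R = 0].

Definition effective_domain (R : realType) (f : R -> \bar R) : set R :=
  [set t | f t < +oo].

Definition fenchel_conjugate (R : realType) (f : R -> \bar R) (x : R) : \bar R :=
  ereal_sup [set (x * t)%:E - f t | t in effective_domain f].

Definition c_transform (X : Type) (R : realType) (c : X -> X -> R) (D : X -> R)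
    (x : X) : \bar R :=
  ereal_sup [set (D y - c x y)%:E | y in setT].

Definition c_concave (X : Type) (R : realType) (c : X -> X -> R) (D : X -> R)
    : Prop :=
  exists phi : X -> R,
    forall y, (D y)%:E = ereal_inf [set (phi x + c x y)%:E | x in setT].

(* In the extended reals 0 * y = 0 for all y and p / 0 = +oo for p > 0, so
   the integrand is 0 where p = 0 and +oo where p > 0 = q. *)
Definition KL d (X : measurableType d) (R : realType)
    (mu : {measure set X -> \bar R}) (p q : X -> R) : \bar R :=
  \int[mu]_x ((p x)%:E * lne ((p x)%:E / (q x)%:E)).

Definition JSD d (X : measurableType d) (R : realType)
    (mu : {measure set X -> \bar R}) (p q : X -> R) : \bar R :=
  let m := fun x => ((p x + q x) / 2)%R in
  (2^-1)%:E * KL mu p m + (2^-1)%:E * KL mu q m.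

(* p f(q / p), with the usual convention
   0 f(q / 0) = q * lim_(t -> +oo) f(t) / t. *)
Definition f_div_integrand (R : realType) (f : R -> \bar R) (p q : R) : \bar R :=
  if p == 0%R then q%:E * lim ((t^-1)%:E * f t @[t --> +oo%R])
  else p%:E * f (q / p)%R.

Definition f_divergence d (X : measurableType d) (R : realType)
    (mu : {measure set X -> \bar R}) (f : R -> \bar R) (p q : X -> R) : \bar R :=
  \int[mu]_x f_div_integrand f (p x) (q x).

Inductive objective (X : Type) (R : realType) : Type :=
| Classic
| Wasserstein of (X -> X -> R)
| FGAN of (R -> \bar R).
Arguments Classic {X R}.

Definition objective_ok (X : Type) (R : realType) (k : objective X R) : Prop :=
  match k with
  | Classic => True
  | Wasserstein c =>
      (forall x y, (0 <= c x y)%R) /\ (forall x, c x x = 0%R)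
  | FGAN f => f_divergence_generator f
  end.

Definition admissible d (X : measurableType d) (R : realType)
    (k : objective X R) (D : X -> R) : Prop :=
  match k with
  | Classic => measurable_fun setT D /\ forall x, (0 <= D x <= 1)%R
  | Wasserstein c => c_concave c D
  | FGAN f =>
      measurable_fun setT D /\
      forall x, effective_domain (fenchel_conjugate f) (D x)
  end.

(* [lne] takes the value -oo at 0. *)
Definition V_obj d (X : measurableType d) (R : realType) (k : objective X R)
    (Pr Pg : probability X R) (D : X -> R) : \bar R :=
  match k with
  | Classic =>
      (2^-1)%:E * \int[Pr]_x lne (D x)%:E +
      (2^-1)%:E * \int[Pg]_x lne (1 - D x)%:E
  | Wasserstein c => \int[Pr]_x (D x)%:E - \int[Pg]_x c_transform c D x
  | FGAN f => \int[Pr]_x (D x)%:E - \int[Pg]_x fenchel_conjugate f (D x)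
  end.

(* For [Classic], both expectations are those of nonpositive measurable
   functions as soon as [D] is admissible. *)
Definition V_defined d (X : measurableType d) (R : realType) (k : objective X R)
    (Pr Pg : probability X R) (D : X -> R) : Prop :=
  match k with
  | Classic => True
  | Wasserstein c => difference_defined Pr Pg (EFin \o D) (c_transform c D)
  | FGAN f =>
      difference_defined Pr Pg (EFin \o D) (fenchel_conjugate f \o D)
  end.

(* W_c (Pg || Pr) *)
Definition W_div d (X : measurableType d) (R : realType) (c : X -> X -> R)
    (Pg Pr : probability X R) : \bar R :=
  ereal_sup [set \int[Pr]_x (D x)%:E - \int[Pg]_x c_transform c D x
            | D in [set D : X -> R | c_concave c D /\
                difference_defined Pr Pg (EFin \o D) (c_transform c D)]].

(* DIV (Pg || Pr), where [pg] and [pr] are densities of [Pg] and [Pr] with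
   respect to [mu]. *)
Definition DIV d (X : measurableType d) (R : realType)
    (mu : {measure set X -> \bar R}) (k : objective X R)
    (Pg Pr : probability X R) (pg pr : X -> R) : \bar R :=
  match k with
  | Classic => JSD mu pg pr
  | Wasserstein c => W_div c Pg Pr
  | FGAN f => f_divergence mu f pg pr
  end.

(* [nrm] is a seminorm on the linear space [E] of functions. *)
Definition seminorm_on (X : Type) (R : realType) (E : set (X -> R))
    (nrm : (X -> R) -> R) : Prop :=
  [/\ E (fun=> 0%R),
      forall (a : R) u v, E u -> E v -> E (fun x => a * u x + v x)%R,
      forall u, E u -> (0 <= nrm u)%R,
      forall (a : R) u, E u -> nrm (fun x => a * u x)%R = (`|a| * nrm u)%R &
      forall u v, E u -> E v -> (nrm (fun x => u x + v x) <= nrm u + nrm v)%R].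

Definition proximal_equilibrium (X : Type) (R : realType) (TD TG : Type)
    (D : TD -> X -> R) (V : TD -> TG -> \bar R) (nrm : (X -> R) -> R)
    (lambda : R) (td0 : TD) (tg0 : TG) : Prop :=
  (forall td, V td tg0 <= V td0 tg0) /\
  (forall tg, exists m,
     is_maximum
       (range (fun td =>
          V td tg - (lambda * nrm (fun x => D td x - D td0 x) ^+ 2)%:E)) m /\
     V td0 tg0 <= m).

(* Main.v *)
(** At a proximal equilibrium the generator [tg0] minimizes the inner maximum
    [M tg := max_td V td tg]: the penalty is nonnegative, so
    [M tg0 = V td0 tg0 <= M tg] for every [tg].  It remains to see that [M] and
    the divergence differ by a constant.  For Wasserstein GANs this is the
    definition of [W_c].  For classic GANs the integrand is maximized pointwise
    by [pr / (pr + pg)], with value [JSD - ln 2].  For f-GANs, Fenchel-Young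
    gives [V <= D_f]; conversely [p f(q / p)] is the supremum of
    [a q - f^*(a) p] over a sequence of slopes [a] in the domain of [f^*]
    (Fenchel-Moreau, the case [p = 0] being [sup (dom f^* ) = lim f(t) / t]),
    and the discriminators that select the best of the first [n] slopes have
    objectives converging to [D_f] by monotone convergence. *)

Require Import Defs.
From HB Require Import structures.
From mathcomp Require Import all_boot all_order all_algebra.
From mathcomp Require Import all_classical all_reals all_analysis measurable_realfun.
From mathcomp Require Import ring lra.
Import Order.TTheory GRing.Theory Num.Theory.
Import numFieldNormedType.Exports.
Local Open Scope classical_set_scope.
Local Open Scope ring_scope.

Set Implicit Arguments.
Unset Strict Implicit.
Unset Printing Implicit Defensive.

(** * Change of measure: expectations as integrals against a density *)

Section density.
Local Open Scope ereal_scope.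
Context d (X : measurableType d) (R : realType) (mu : {measure set X -> \bar R}).
Context (P : probability X R) (p : X -> R) (hp : is_density mu P p).

Import HBNNSimple.

Lemma integral_density_nnsfun (h : {nnsfun X >-> R}) :
  \int[P]_x (h x)%:E = \int[mu]_x ((h x)%:E * (p x)%:E).
Proof.
have [mp p0 Pp] := hp.
under [LHS]eq_integral do rewrite fimfunE -fsumEFin//.
rewrite ge0_integral_fsum//; last 2 first.
- by move=> y; exact/measurable_EFinP/measurable_funM.
- by move=> y x _; rewrite nnfun_muleindic_ge0.
transitivity (\sum_(k \in range h)
    \int[mu]_x ((k * \1_(h @^-1` [set k]) x)%:E * (p x)%:E)).
  apply: eq_fsbigr => r /[!inE] -[x0 _ hx0].
  have r0 : (0 <= r)%R by rewrite -hx0.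
  rewrite integralZl_indic_nnsfun// integral_indic// setIT [X in _ * X]Pp//.
  under [RHS]eq_integral do rewrite EFinM -muleA.
  rewrite ge0_integralZl_EFin//; last 2 first.
  - by move=> x _; rewrite mule_ge0// lee_fin.
  - by apply: emeasurable_funM; apply/measurable_EFinP.
  congr (_ * _); rewrite integral_mkcond; apply: eq_integral => x _.
  by rewrite patchE indicE; case: ifPn => _; rewrite ?mul1e ?mul0e.
rewrite -ge0_integral_fsum//.
- apply: eq_integral => x _.
  by rewrite -ge0_mule_fsuml ?fsumEFin// => [|r]; rewrite -?fimfunE// nnfun_muleindic_ge0.
- move=> r; apply: emeasurable_funM; last exact/measurable_EFinP.
  exact/measurable_EFinP/measurable_funM.
- by move=> r x _; rewrite mule_ge0 ?lee_fin// -?lee_fin ?nnfun_muleindic_ge0.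
Qed.

(** Both sides pass to increasing limits, so it suffices to treat simple functions, where the
    density formula applies on each level set. *)
Lemma ge0_integral_density (h : X -> \bar R) :
  measurable_fun setT h -> (forall x, 0 <= h x) ->
  \int[P]_x h x = \int[mu]_x (h x * (p x)%:E).
Proof.
move=> mh h0; have [mp p0 _] := hp.
pose h_ := nnsfun_approx measurableT mh.
have cvgh x : (EFin \o h_^~ x) n @[n --> \oo] --> h x.
  by apply: cvg_nnsfun_approx.
transitivity (limn (fun n => \int[P]_x (h_ n x)%:E)).
  rewrite -monotone_convergence//.
  - by apply: eq_integral => x _; apply/esym/cvg_lim => //; exact: cvgh.
  - by move=> n; exact/measurable_EFinP/measurable_funP.
  - by move=> n x _; rewrite lee_fin.
  - by move=> x _ m n mn; rewrite lee_fin; exact/lefP/nd_nnsfun_approx.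
under eq_fun do rewrite integral_density_nnsfun.
rewrite -monotone_convergence//.
- apply: eq_integral => x _; apply/cvg_lim => //.
  by apply: cvgeZr => //; exact: cvgh.
- move=> n; apply: emeasurable_funM; last exact/measurable_EFinP.
  exact/measurable_EFinP/measurable_funP.
- by move=> n x _; rewrite mule_ge0// lee_fin.
- move=> x _ m n mn; rewrite lee_pmul ?lee_fin//.
  exact/lefP/nd_nnsfun_approx.
Qed.

Lemma integral_density_pdf : \int[mu]_x (p x)%:E = 1.
Proof. by have [_ _ /(_ _ measurableT) <-] := hp; rewrite probability_setT. Qed.

Lemma integrable_density_pdf : mu.-integrable setT (EFin \o p).
Proof.
have [mp p0 _] := hp; apply/integrableP; split; first exact/measurable_EFinP.
under eq_integral do rewrite /= ger0_norm//.
by rewrite integral_density_pdf ltry.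
Qed.

Lemma integrable_density (g : X -> R) : P.-integrable setT (EFin \o g) ->
  mu.-integrable setT (fun x => (g x * p x)%:E).
Proof.
have [mp p0 _] := hp => /integrableP[/measurable_EFinP mg ig].
apply/integrableP; split; first exact/measurable_EFinP/measurable_funM.
under eq_integral do rewrite /= normrM (ger0_norm (p0 _)) EFinM.
by rewrite -(@ge0_integral_density (fun x => `|(g x)%:E|))//;
  exact/measurable_EFinP/measurableT_comp.
Qed.

(** Multiplication by [p >= 0] commutes with taking positive and negative parts, so the equality
    also holds when the integrals are infinite. *)
Lemma integral_density (g : X -> R) : measurable_fun setT g ->
  \int[P]_x (g x)%:E = \int[mu]_x (g x * p x)%:E.
Proof.
have [mp p0 _] := hp => mg; rewrite [LHS]integralE [RHS]integralE.
have mg' : measurable_fun setT (EFin \o g) by exact/measurable_EFinP.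
rewrite !ge0_integral_density//.
- congr (_ - _); apply: eq_integral => x _.
    by rewrite !funeposE maxe_pMl ?lee_fin ?p0// mul0e EFinM.
  by rewrite !funenegE maxe_pMl ?lee_fin ?p0// mul0e mulNe EFinM.
- exact: measurable_funeneg.
- exact: measurable_funepos.
Qed.

End density.

(** * Classic GANs *)

Section classic_pointwise.
Local Open Scope ereal_scope.
Context {R : realType}.
Implicit Types a b t : R.

(** The pointwise cost at the optimal discriminator value [a / (a + b)]. For nonnegative arguments
    it can be real-valued, as the factor [a] vanishes wherever the logarithm would be infinite. *)
Definition cross_ent a b : R := (a * - ln (a / (a + b)))%R.

Lemma cross_ent_ge0 a b : (0 <= a)%R -> (0 <= b)%R -> (0 <= cross_ent a b)%R.
Proof.
move=> a0 b0; rewrite /cross_ent mulr_ge0// oppr_ge0 ln_le0//.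
have [s0|s0] := leP (a + b)%R 0%R; last by rewrite ler_pdivrMr// mul1r lerDl.
have /eqP -> : a == 0%R by rewrite eq_le a0 andbT (le_trans _ s0)// lerDl.
by rewrite mul0r.
Qed.

(** This is [ln u <= u - 1] at [u = t (a + b) / a]: the cost as a function of [t] lies above its
    tangent at the optimum [a / (a + b)]. *)
Lemma cross_ent_lee a b t : (0 <= a)%R -> (0 <= b)%R -> (0 <= t)%R ->
  (cross_ent a b + a - t * (a + b))%:E <= a%:E * - lne t%:E.
Proof.
rewrite le_eqVlt => /predU1P[<-|a0] b0 t0.
  by rewrite /cross_ent !mul0r mul0e add0r !add0r lee_fin oppr_le0 mulr_ge0.
move: t0; rewrite le_eqVlt => /predU1P[<-|t0].
  by rewrite le0_lneNy// gt0_muley ?lte_fin// leey.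
have s0 : (0 < a + b)%R by rewrite ltr_pwDl.
rewrite lne_EFin// -EFinN -EFinM lee_fin /cross_ent.
have := @le_ln1Dx _ (t / (a / (a + b)) - 1)%R.
rewrite (addrC 1%R) subrK ltrBrDl subrr.
have u0 : (0 < a / (a + b))%R by rewrite divr_gt0.
rewrite divr_gt0// => /(_ isT); rewrite ln_div ?posrE// => H.
have {H} : (a * (ln t - ln (a / (a + b))) <= a * (t / (a / (a + b)) - 1))%R.
  by rewrite ler_pM2l.
have -> : (a * (t / (a / (a + b)) - 1) = t * (a + b) - a)%R.
  by field; rewrite !gt_eqF.
by rewrite mulrBr !mulrN => H; lra.
Qed.

(** The tangent bound at [t = 1], where the cost is zero. It dominates the cross entropy by the
    other density, hence makes it integrable. *)
Lemma cross_ent_le a b : (0 <= a)%R -> (0 <= b)%R -> (cross_ent a b <= b)%R.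
Proof.
move=> a0 b0; have := @cross_ent_lee a b 1%R a0 b0 ler01.
rewrite lne1 oppe0 mule0 lee_fin => H; lra.
Qed.

Lemma cross_entE a b : (0 <= a)%R -> (0 <= b)%R ->
  a%:E * - lne (a / (a + b))%:E = (cross_ent a b)%:E.
Proof.
rewrite le_eqVlt => /predU1P[<-|a0] b0; first by rewrite /cross_ent !mul0r mul0e.
by rewrite lne_EFin// divr_gt0// ltr_pwDl.
Qed.

Lemma cross_entE' a b : (0 <= a)%R -> (0 <= b)%R ->
  b%:E * - lne (1 - a / (a + b))%:E = (cross_ent b a)%:E.
Proof.
move=> a0; rewrite le_eqVlt => /predU1P[<-|b0].
  by rewrite /cross_ent !mul0r mul0e.
rewrite -cross_entE ?(ltW b0)//; congr (_ * - lne _%:E).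
by rewrite [in RHS]addrC; field; rewrite gt_eqF// ltr_wpDl.
Qed.

Lemma KL_midpointE a b : (0 <= a)%R -> (0 <= b)%R ->
  a%:E * lne (a%:E / ((a + b) / 2)%:E) = (a * ln 2 - cross_ent a b)%:E.
Proof.
rewrite le_eqVlt => /predU1P[<-|a0] b0.
  by rewrite /cross_ent !mul0r mul0e subrr.
have s0 : (0 < a + b)%R by rewrite ltr_pwDl.
rewrite inver gt_eqF ?divr_gt0// -EFinM.
rewrite lne_EFin; last by rewrite !mulr_gt0// invr_gt0 divr_gt0.
have -> : (a * ((a + b) / 2)^-1 = 2 * (a / (a + b)))%R by field; rewrite gt_eqF.
by rewrite lnM ?posrE ?divr_gt0// -EFinM mulrDr /cross_ent mulrN opprK.
Qed.

End classic_pointwise.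

Section classic_expectation.
Local Open Scope ereal_scope.
Context d (X : measurableType d) (R : realType) (mu : {measure set X -> \bar R}).
Context (P : probability X R) (p : X -> R) (hp : is_density mu P p).

Lemma measurable_lne_EFin (D : X -> R) : measurable_fun setT D ->
  measurable_fun setT (fun x => lne (D x)%:E).
Proof.
move=> mD; apply: measurable_fun_ifT => //.
- exact: measurable_fun_ler.
- by apply/measurable_EFinP; apply: measurableT_comp.
Qed.

Lemma integral_lne_density (D : X -> R) : measurable_fun setT D ->
  (forall x, (D x <= 1)%R) ->
  \int[P]_x lne (D x)%:E = - \int[mu]_x ((p x)%:E * - lne (D x)%:E).
Proof.
move=> mD D1.
have l0 x : 0 <= - lne (D x)%:E by rewrite oppe_ge0 lne_le0 lee_fin.
under [LHS]eq_integral do rewrite -(oppeK (lne _)).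
rewrite integral_ge0N//; congr (- _).
rewrite (@ge0_integral_density _ _ _ _ _ _ hp)//.
- by apply: eq_integral => x _; rewrite muleC.
- by apply: measurableT_comp => //; exact: measurable_lne_EFin.
Qed.

End classic_expectation.

Section classic_optimal.
Local Open Scope ereal_scope.
Context d (X : measurableType d) (R : realType) (mu : {measure set X -> \bar R}).
Context (P Q : probability X R) (p q : X -> R).
Hypotheses (hp : is_density mu P p) (hq : is_density mu Q q).

Let mp : measurable_fun setT p. Proof. by case: hp. Qed.
Let mq : measurable_fun setT q. Proof. by case: hq. Qed.
Let p0 x : (0 <= p x)%R. Proof. by case: hp. Qed.
Let q0 x : (0 <= q x)%R. Proof. by case: hq. Qed.

(** With the sign taken out, both integrands are nonnegative, so the two expectations merge into one
    integral even if they are infinite. *)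
Lemma V_obj_ClassicE (D : X -> R) : admissible Classic D ->
  V_obj Classic P Q D =
  - ((2^-1)%:E * \int[mu]_x ((p x)%:E * - lne (D x)%:E +
                             (q x)%:E * - lne (1 - D x)%:E)).
Proof.
move=> [mD D01] /=.
have m1D : measurable_fun setT (fun x => 1 - D x)%R by exact: measurable_funB.
have D1 x : (D x <= 1)%R by case/andP: (D01 x).
have D0 x : (1 - D x <= 1)%R by rewrite gerBl; case/andP: (D01 x).
have l0 x : 0 <= - lne (D x)%:E by rewrite oppe_ge0 lne_le0 lee_fin.
have l1 x : 0 <= - lne (1 - D x)%:E by rewrite oppe_ge0 lne_le0 lee_fin.
have pl0 x : 0 <= (p x)%:E * - lne (D x)%:E by rewrite mule_ge0// lee_fin.
have ql0 x : 0 <= (q x)%:E * - lne (1 - D x)%:E by rewrite mule_ge0// lee_fin.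
rewrite (integral_lne_density hp)// (integral_lne_density hq)//.
rewrite ge0_integralD//; last 2 first.
- apply: emeasurable_funM; first exact/measurable_EFinP.
  by apply: measurableT_comp => //; exact: measurable_lne_EFin.
- apply: emeasurable_funM; first exact/measurable_EFinP.
  by apply: measurableT_comp => //; exact: measurable_lne_EFin.
rewrite !muleN [in RHS]ge0_muleDr ?integral_ge0// oppeD//.
by rewrite ge0_adde_def// inE mule_ge0// ?lee_fin ?integral_ge0.
Qed.

Lemma measurable_ratio : measurable_fun setT (fun x => p x / (p x + q x))%R.
Proof.
apply: measurable_funM => //.
(* On nonnegative reals, [0] included, inversion is the power function with exponent [-1], which is
   measurable. *)
rewrite [X in measurable_fun _ X](_ : _ = (@powR R ^~ (-1)%R) \o (p \+ q)%R).
  by apply: measurableT_comp => //; exact: measurable_funD.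
by apply/funext => x /=; rewrite powR_inv1// addr_ge0.
Qed.

Lemma integrable_cross_ent :
  mu.-integrable setT (fun x => (cross_ent (p x) (q x))%:E).
Proof.
apply: (le_integrable _ _ _ (integrable_density_pdf hq)) => //.
- apply/measurable_EFinP; apply: measurable_funM => //.
  apply: measurable_funN; apply: measurableT_comp => //.
  exact: measurable_ratio.
- move=> x _ /=; rewrite lee_fin !ger0_norm ?cross_ent_ge0//.
  exact: cross_ent_le.
Qed.

Lemma KL_midpoint :
  KL mu p (fun x => (p x + q x) / 2)%R =
  (ln 2)%:E - \int[mu]_x (cross_ent (p x) (q x))%:E.
Proof.
rewrite /KL; under eq_integral do rewrite KL_midpointE// EFinB mulrC EFinM.
rewrite integralB//.
- rewrite integralZl; first by rewrite (integral_density_pdf hp) mule1.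
    exact: measurableT.
  exact: (integrable_density_pdf hp).
- by apply: integrableZl => //; exact: (integrable_density_pdf hp).
- exact: integrable_cross_ent.
Qed.

End classic_optimal.

Lemma JSD_eq_V_obj_Classic d (X : measurableType d) (R : realType)
    (mu : {measure set X -> \bar R}) (P Q : probability X R) (p q : X -> R) :
    is_density mu P p -> is_density mu Q q ->
  let D x := p x / (p x + q x) in
  admissible Classic D /\ JSD mu q p = ((ln 2)%:E + V_obj Classic P Q D)%E.
Proof.
move=> hp hq D; have [_ p0 _] := hp; have [_ q0 _] := hq.
have aD : admissible Classic D.
  split; first exact: (measurable_ratio hp hq).
  move=> x; rewrite divr_ge0 ?addr_ge0//=.
  (* Where both densities vanish, the ratio is [0 / 0 = 0], still in [[0, 1]]. *)
  have [s0|s0] := leP (p x + q x) 0; last by rewrite ler_pdivrMr// mul1r lerDl.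
  have /eqP : p x + q x == 0 by rewrite eq_le s0 addr_ge0.
  by rewrite /D => ->; rewrite invr0 mulr0.
split => //; rewrite (V_obj_ClassicE hp hq)//.
under eq_integral do rewrite cross_entE// cross_entE'//.
have ipq := integrable_cross_ent hp hq; have iqp := integrable_cross_ent hq hp.
rewrite integralD// /JSD (KL_midpoint hq hp).
under [X in KL mu p X]eq_fun do rewrite addrC.
rewrite (KL_midpoint hp hq).
(* Both cross entropies are finite, so the claim becomes a linear identity between reals. *)
have := integrable_fin_num measurableT ipq.
have := integrable_fin_num measurableT iqp.
case: (\int[mu]_x _)%E => // u _; case: (\int[mu]_x _)%E => // v _.
by rewrite -?(EFinN, EFinD, EFinM); congr EFin; lra.
Qed.

Lemma V_obj_Classic_le d (X : measurableType d) (R : realType)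
    (mu : {measure set X -> \bar R}) (P Q : probability X R) (p q : X -> R)
    (D : X -> R) :
    is_density mu P p -> is_density mu Q q -> admissible Classic D ->
  (V_obj Classic P Q D <= V_obj Classic P Q (fun x => p x / (p x + q x))%R)%E.
Proof.
move=> hp hq aD; have [mp p0 _] := hp; have [mq q0 _] := hq.
have [aD' _] := JSD_eq_V_obj_Classic hp hq.
rewrite !(V_obj_ClassicE hp hq)// leeN2 lee_wpmul2l ?lee_fin//.
under eq_integral do rewrite cross_entE// cross_entE'//.
have [mD D01] := aD.
have D0 x : (0 <= D x)%R by case/andP: (D01 x).
have D1 x : (0 <= 1 - D x)%R by rewrite subr_ge0; case/andP: (D01 x).
apply: ge0_le_integral => //.
- by move=> x _; rewrite adde_ge0// lee_fin cross_ent_ge0.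
- apply: emeasurable_funD; apply: measurable_int.
    exact: (integrable_cross_ent hp hq).
  exact: (integrable_cross_ent hq hp).
- apply: emeasurable_funD; apply: emeasurable_funM; try exact/measurable_EFinP.
    by apply: measurableT_comp => //; exact: measurable_lne_EFin.
  apply: measurableT_comp => //; apply: measurable_lne_EFin.
  exact: measurable_funB.
(* The tangent bounds at [D x] and at [1 - D x] are added; their linear terms cancel. *)
- move=> x _; apply: le_trans; last first.
    by apply: leeD; [exact: (@cross_ent_lee _ _ (q x))|exact: (@cross_ent_lee _ _ (p x))].
  by rewrite -!EFinD lee_fin; lra.
Qed.

Lemma JSD_eq_sup_V_obj d (X : measurableType d) (R : realType)
    (mu : {measure set X -> \bar R}) (P Q : probability X R) (p q : X -> R) :
    is_density mu P p -> is_density mu Q q ->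
  JSD mu q p =
  ((ln 2)%:E + ereal_sup [set V_obj Classic P Q D | D in admissible Classic])%E.
Proof.
move=> hp hq; have [aD ->] := JSD_eq_V_obj_Classic hp hq; congr (_ + _)%E.
apply/eqP; rewrite eq_le; apply/andP; split.
  by apply: ereal_sup_ubound; exists (fun x => p x / (p x + q x)).
apply: ge_ereal_sup => _ [D' aD' <-]; exact: (V_obj_Classic_le hp hq).
Qed.

(** * Convex conjugates of generators of f-divergences *)

Lemma lte_EFin_between {R : realType} (r : R) (x : \bar R) :
  (r%:E < x)%E -> exists2 r', r < r' & (r'%:E < x)%E.
Proof.
case: x => [v|_|//].
  by rewrite lte_fin => rv; exists ((r + v) / 2); rewrite ?lte_fin; lra.
by exists (r + 1); rewrite ?ltry// ltrDl.
Qed.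

Lemma lee_of_lt_EFin {R : realType} (x y : \bar R) :
  (forall r : R, (r%:E < x)%E -> (r%:E <= y)%E) -> (x <= y)%E.
Proof.
move=> xy; rewrite leNgt; apply/negP => yx.
case: y xy yx => [y| |] xy yx.
- by have [r yr /xy] := lte_EFin_between yx; rewrite lee_fin leNgt yr.
- by move: yx; rewrite ltNge leey.
- case: x xy yx => [x| |//] xy _.
    by have := xy (x - 1); rewrite lte_fin gtrBl => /(_ ltr01); rewrite leNgt ltNyr.
  by have := xy 0 (ltry _); rewrite leNgt ltNyr.
Qed.

(* Density in the graph of [g], not only in [A]: this is what makes suprema of
   [a x - g a y] over [A] countable, without any continuity of [g]. *)
Lemma dense_sequence_graph {R : realType} (A : set R) (g : R -> R) :
  A !=set0 -> exists2 s : nat -> R, forall i, A (s i) &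
    forall a e, A a -> 0 < e ->
      exists i, `|s i - a| < e /\ `|g (s i) - g a| < e.
Proof.
move=> [a0 Aa0].
(* Countably many rational boxes cover the plane at every scale; each box that meets the graph
   contributes one chosen point, the others default to [a0]. *)
pose Q (w : rat * rat * nat) a :=
  [/\ A a, `|a - ratr w.1.1| < w.2.+1%:R^-1 & `|g a - ratr w.1.2| < w.2.+1%:R^-1].
pose s i := if unpickle i is Some w then
  (if pselect (exists a, Q w a) is left h then projT1 (cid h) else a0) else a0.
have sQ w : (exists a, Q w a) -> Q w (s (pickle w)).
  by rewrite /s pickleK; case: pselect => // h _; case: cid.
exists s => [i|a e Aa e0].
  rewrite /s; case: unpickle => // w; case: pselect => // h.
  by case: cid => ? [].
have [m me] : exists m : nat, m.+1%:R^-1 < e / 2.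
  have e20 : 0 < e / 2 by rewrite divr_gt0.
  have [m _ mP] := near_infty_natSinv_lt (PosNum e20); exists m.
  exact: (mP m (leqnn m)).
have m0 : 0 < m.+1%:R^-1 :> R by rewrite invr_gt0.
have approx (x : R) : exists u : rat, `|x - ratr u| < m.+1%:R^-1.
  have [u /andP[xu ux]] : exists u : rat, x < ratr u < x + m.+1%:R^-1.
    have [u] := rat_in_itvoo (ltr_pwDr m0 (lexx x)).
    by rewrite in_itv/= => ux; exists u.
  by exists u; rewrite ltr_distlC ltrBlDr ux (lt_trans xu)// ltrDl.
have [u au] := approx a; have [v gv] := approx (g a).
have [_ su sv] : Q (u, v, m) (s (pickle (u, v, m))) by apply: sQ; exists a.
exists (pickle (u, v, m)); split.
  rewrite (le_lt_trans (ler_distD (ratr u) _ _))//.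
  by rewrite [X in _ + X]distrC (splitr e) ltrD// (lt_trans _ me).
rewrite (le_lt_trans (ler_distD (ratr v) _ _))//.
by rewrite [X in _ + X]distrC (splitr e) ltrD// (lt_trans _ me).
Qed.

Section fenchel.
Local Open Scope ereal_scope.
Context {R : realType} (f : R -> \bar R) (hf : f_divergence_generator f).

Let fNy t : -oo < f t. Proof. by case: hf. Qed.
Let f_convex s t a : (0 <= a <= 1)%R ->
  f (a * s + (1 - a) * t)%R <= a%:E * f s + (1 - a)%:E * f t.
Proof. by case: hf => _ _ + _ _; apply. Qed.
Let f_lsc : lower_semicontinuous f. Proof. by case: hf. Qed.
Let f1 : f 1%R = 0. Proof. by case: hf. Qed.

Lemma lsc_ball t r : r%:E < f t ->
  exists2 e : R, (0 < e)%R & forall y, (`|y - t| < e)%R -> r%:E < f y.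
Proof.
move=> /f_lsc[V /nbhs_ballP[e /= e0 eV] Vf]; exists e => // y ye.
by apply: Vf; apply: eV; rewrite /ball/= distrC.
Qed.

(** Near [1] lower semicontinuity gives the bound [-1]. A farther point is pulled by convexity along
    the chord to [1], where [f] vanishes, into that neighbourhood. *)
Lemma generator_minorant :
  exists2 K : R, (0 < K)%R & forall t, (- 1 - K * `|t - 1|)%:E <= f t.
Proof.
have [|e e0 ef] := @lsc_ball 1%R (- 1)%R; first by rewrite f1 lte_fin ltrN10.
exists (2 / e)%R; first by rewrite divr_gt0.
move=> t; have [te|te] := ltP `|t - 1|%R e.
  apply: le_trans (ltW (ef _ te)); rewrite lee_fin.
  by rewrite gerDl oppr_le0 mulr_ge0// divr_ge0// ltW.
have t0 : (0 < `|t - 1|)%R by exact: lt_le_trans te.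
(* The weight that places [a * t + (1 - a) * 1] at distance [e / 2] from [1]. *)
pose a := (e / 2 / `|t - 1|)%R.
have a0 : (0 < a)%R by rewrite !divr_gt0.
have a1 : (a <= 1)%R by rewrite ler_pdivrMr// mul1r; lra.
have : (- 1)%:E < a%:E * f t.
  have := @f_convex t 1%R a; rewrite ltW// a1 => /(_ isT).
  rewrite f1 mule0 adde0; apply: lt_le_trans; apply: ef.
  have -> : (a * t + (1 - a) * 1 - 1 = a * (t - 1))%R by ring.
  rewrite normrM (gtr0_norm a0) divfK ?gt_eqF//; lra.
have := fNy t; case: (f t) => [v|//|//] _; last by rewrite leey.
rewrite -EFinM lte_fin lee_fin => av.
have : (- 1 / a < v)%R by rewrite ltr_pdivrMr// mulrC.
have -> : (-1 / a = - (2 / e * `|t - 1|))%R.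
  by rewrite /a; field; rewrite !gt_eqF.
lra.
Qed.

(** The cone below [f] is moved to the tip [(t0, r)]; it will bound the slopes of chords from that
    point. *)
Lemma generator_minorant_at t0 r : r%:E < f t0 ->
  exists2 C : R, (0 <= C)%R & forall t, (r - C * `|t - t0|)%:E <= f t.
Proof.
move=> /lsc_ball[e e0 ef]; have [K K0 Kf] := generator_minorant.
(* [B] bounds the loss in moving the tip; off the ball, where the distance to [t0] is at least [e],
   the extra slope [B / e] makes up for it. *)
pose B := (1 + K * `|t0 - 1| + `|r|)%R.
have B0 : (0 <= B)%R by rewrite !addr_ge0// mulr_ge0// ltW.
have C0 : (0 <= B / e + K)%R by rewrite addr_ge0// ?(ltW K0)// divr_ge0// ltW.
exists (B / e + K)%R => //.
move=> t; have [te|te] := ltP `|t - t0|%R e.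
  apply: le_trans (ltW (ef _ te)); rewrite lee_fin.
  by rewrite gerDl oppr_le0 mulr_ge0.
apply: le_trans (Kf t); rewrite lee_fin.
have H1 : (B <= B / e * `|t - t0|)%R.
  by rewrite mulrAC ler_pdivlMr// ler_wpM2l.
have H2 : (K * `|t - 1| <= K * `|t - t0| + K * `|t0 - 1|)%R.
  by rewrite -mulrDr ler_wpM2l ?(ltW K0)// ler_distD.
have := ler_norm r; rewrite mulrDl; rewrite /B in H1 *; lra.
Qed.

(* The slope is the supremum of the slopes of the chords to the left of [t0],
   bounded below artificially so that the supremum exists even when [f] is
   infinite on the left of [t0]. *)
Lemma generator_supporting_line t0 r : r%:E < f t0 ->
  exists a : R, forall t, (r + a * (t - t0))%:E <= f t.
Proof.
move=> rf; have [C C0 Cf] := generator_minorant_at rf.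
pose S := [set x : R | x = (- C)%R \/
  exists t v, [/\ (t < t0)%R, f t = v%:E & x = ((r - v) / (t0 - t))%R]].
have SC : ubound S C.
  move=> _ [->|[t [v [tt0 ftv ->]]]]; first by rewrite ge0_cp.
  rewrite ler_pdivrMr ?subr_gt0//.
  have := Cf t; rewrite ftv lee_fin distrC gtr0_norm ?subr_gt0//; lra.
have S0 : S !=set0 by exists (- C)%R; left.
exists (sup S) => t; have := fNy t.
case ftv : (f t) => [v|//|//] _; last by rewrite leey.
rewrite lee_fin; have [tt0|t0t|tt0] := ltgtP t t0.
- have : ((r - v) / (t0 - t) <= sup S)%R.
    by apply: ub_le_sup; [exists C|right; exists t, v].
  rewrite ler_pdivrMr ?subr_gt0//; lra.
- suff : (sup S <= (v - r) / (t - t0))%R.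
    rewrite ler_pdivlMr ?subr_gt0//; lra.
  apply: ge_sup => // _ [->|[s [w [st0 fsw ->]]]].
    rewrite ler_pdivlMr ?subr_gt0//.
    have := Cf t; rewrite ftv lee_fin gtr0_norm ?subr_gt0//; lra.
  (* For [s < t0 < t], convexity puts [(t0, r)] below the chord from [s] to [t], so the left chord
     slope is at most the right one. *)
  have ts : (0 < t - s)%R by rewrite subr_gt0 (lt_trans st0).
  rewrite ler_pdivrMr ?subr_gt0// mulrAC ler_pdivlMr ?subr_gt0//.
  have := @f_convex s t ((t - t0) / (t - s))%R.
  have -> : (0 <= (t - t0) / (t - s) <= 1)%R.
    rewrite ler_pdivrMr// mul1r; apply/andP; split; last by lra.
    by rewrite divr_ge0 ?(ltW ts)// subr_ge0 ltW.
  move=> /(_ isT).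
  have -> : ((t - t0) / (t - s) * s + (1 - (t - t0) / (t - s)) * t = t0)%R.
    by field; rewrite gt_eqF.
  move=> /(lt_le_trans rf); rewrite fsw ftv lte_fin => H.
  have {H} : (r * (t - s) < (t - t0) * w + (t0 - s) * v)%R.
    rewrite -ltr_pdivlMr//; apply: lt_le_trans H _.
    by rewrite le_eqVlt; apply/orP; left; apply/eqP; field; rewrite gt_eqF.
  lra.
- by move: rf; rewrite -tt0 ftv lte_fin subrr mulr0 addr0 => /ltW.
Qed.

Local Notation dom := (effective_domain (fenchel_conjugate f)).
Local Notation fs := (fun a => fine (fenchel_conjugate f a)).

(** The competitor [t = 1], where [f] vanishes. Hence the conjugate is never [-oo], and [fine] loses
    nothing on [dom]. *)
Lemma fenchel_conjugate_ge a : a%:E <= fenchel_conjugate f a.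
Proof.
apply: ereal_sup_ubound; exists 1%R; first by rewrite /effective_domain/= f1 ltry.
by rewrite f1 sube0 mulr1.
Qed.

Lemma fenchel_conjugateK a : dom a -> fenchel_conjugate f a = (fs a)%:E.
Proof.
move=> da; rewrite fineK// fin_numE -ltey andbC [_ < _]da/=.
by rewrite gt_eqF// (lt_le_trans _ (fenchel_conjugate_ge a))// ltNyr.
Qed.

Lemma fenchel_young a t : dom a -> (a * t - fs a)%:E <= f t.
Proof.
move=> /fenchel_conjugateK fa; have := fNy t.
case ftv : (f t) => [v|//|//] _; last by rewrite leey.
rewrite lee_fin lerBlDr -lerBlDl -lee_fin -fa EFinB -ftv.
by apply: ereal_sup_ubound; exists t => //; rewrite /effective_domain/= ftv ltry.
Qed.

Lemma fenchel_conjugate_le a b : (forall t, (a * t - b)%:E <= f t) ->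
  fenchel_conjugate f a <= b%:E.
Proof.
move=> ab; apply: ge_ereal_sup => _ [t dt <-].
have := ab t; have := fNy t; case: (f t) dt => [v|//|//] _ _.
  by rewrite -EFinB !lee_fin; lra.
by rewrite addeNy leNye.
Qed.

(** An affine minorant of [f] through [(t0, r')] with [r < r' < f t0] has its slope [a] in [dom],
    with conjugate value at most [a * t0 - r']. *)
Lemma fenchel_moreau t0 r : r%:E < f t0 ->
  exists2 a, dom a & (r < a * t0 - fs a)%R.
Proof.
move=> /lte_EFin_between[r' rr'] /generator_supporting_line[a ha].
have fa : fenchel_conjugate f a <= (a * t0 - r')%:E.
  by apply: fenchel_conjugate_le => t; apply: le_trans (ha t); rewrite lee_fin; lra.
have da : dom a by exact: le_lt_trans fa (ltry _).
by exists a => //; move: fa; rewrite fenchel_conjugateK// lee_fin; lra.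
Qed.

Lemma dom_fenchel_neq0 : exists a, dom a.
Proof.
have [|a da _] := @fenchel_moreau 1%R (- 1)%R; last by exists a.
by rewrite f1 lte_fin ltrN10.
Qed.

(** By Fenchel-Moreau [f t] is approached by values [a t - f^*(a)], and [f^*(a) >= a] bounds these
    by [a (t - 1)]. *)
Lemma generator_le_slope t s : (1 <= t)%R -> (forall a, dom a -> (a <= s)%R) ->
  f t <= (s * (t - 1))%:E.
Proof.
move=> t1 ds; rewrite leNgt; apply/negP => /fenchel_moreau[a da].
have := fenchel_conjugate_ge a; rewrite fenchel_conjugateK// lee_fin => faa.
have : (a * (t - 1) <= s * (t - 1))%R by rewrite ler_wpM2r ?subr_ge0 ?ds.
lra.
Qed.

(** Fenchel-Young bounds the quotient below by [a - f^*(a) / t] for every slope [a] in [dom]; when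
    the slopes have a finite supremum [s], the bound [s (t - 1)] on [f t] controls it from above. *)
Lemma generator_recession :
  (t^-1)%:E * f t @[t --> +oo%R] --> ereal_sup (EFin @` dom).
Proof.
have lower a t : dom a -> (0 < t)%R -> (a - fs a / t)%:E <= (t^-1)%:E * f t.
  move=> da t0; rewrite lee_pdivlMl// -EFinM.
  have -> : (t * (a - fs a / t) = a * t - fs a)%R by field; rewrite gt_eqF.
  exact: fenchel_young.
case E : (ereal_sup _) => [s| |].
- have ds a : dom a -> (a <= s)%R.
    by move=> da; rewrite -lee_fin -E; apply: ereal_sup_ubound; exists a.
  have upper t : (1 <= t)%R -> f t <= (s * (t - 1))%:E.
    by move=> t1; exact: generator_le_slope.
  apply/fine_cvgP; split.
    exists 1%R; split => // t /ltW t1.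
    have := upper t t1; have := fNy t; case: (f t) => //.
  apply/cvgrPdist_le => e e0.
  have [_ [a da <-] ea] : exists2 x, (EFin @` dom) x & (s - e / 2)%:E < x.
    by apply: ereal_sup_gt; rewrite E lte_fin; lra.
  (* Beyond this threshold [t > 1], as [upper] requires, and the error terms are at most [e] and
     [e / 2]. *)
  exists (1 + `|s| / e + `|fs a| / (e / 2))%R; split; first exact: num_real.
  move=> t ht.
  have h1 : (0 <= `|s| / e)%R by rewrite divr_ge0// ltW.
  have h2 : (0 <= `|fs a| / (e / 2))%R by rewrite divr_ge0// divr_ge0// ltW.
  have t0 : (0 < t)%R by lra.
  have st : (`|s| / t <= e)%R.
    by rewrite ler_pdivrMr// mulrC -ler_pdivrMr//; lra.
  have at_ : (`|fs a| / t <= e / 2)%R.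
    by rewrite ler_pdivrMr// mulrC -ler_pdivrMr ?divr_gt0//; lra.
  have := lower a t da t0; have := upper t; have := fNy t => /=.
  case: (f t) => [v| |//] _ /= ut; last by have := ut ltac:(lra).
  rewrite -EFinM !lee_fin => lowert.
  have {}ut : (v <= s * (t - 1))%R by rewrite -lee_fin; apply: ut; lra.
  have {}ut : (t^-1 * v <= s - s / t)%R.
    by rewrite mulrC ler_pdivrMr// mulrBl divfK ?gt_eqF//; lra.
  have tV : (`|t^-1| = t^-1)%R by rewrite gtr0_norm// invr_gt0.
  have := ler_norm (- s / t)%R; have := ler_norm (fs a / t)%R.
  rewrite !normrM normrN tV => fat sat; move: ea; rewrite lte_fin => ea.
  by rewrite ler_distlC; apply/andP; split; lra.
- apply/cvgeyPge => A.
  have [_ [a da <-] Aa] : exists2 x, (EFin @` dom) x & (A + 1)%:E < x.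
    by apply: ereal_sup_gt; rewrite E ltry.
  exists (1 + `|fs a|)%R; split; first exact: num_real.
  move=> t ht; have t0 : (0 < t)%R by have := normr_ge0 (fs a); lra.
  apply: le_trans (lower a t da t0); rewrite lee_fin.
  have : (fs a / t <= 1)%R.
    by rewrite ler_pdivrMr// mul1r; have := ler_norm (fs a); lra.
  by move: Aa; rewrite lte_fin; lra.
- have [a da] := dom_fenchel_neq0.
  have : a%:E <= -oo by rewrite -E; apply: ereal_sup_ubound; exists a.
  by rewrite leNgt ltNyr.
Qed.

(** For [p > 0] this is Fenchel-Young at [q / p], scaled by [p]; for [p = 0] the integrand is [q]
    times the supremum of the slopes. *)
Lemma f_div_integrand_young a p q : dom a -> (0 <= p)%R -> (0 <= q)%R ->
  (a * q - fs a * p)%:E <= f_div_integrand f p q.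
Proof.
move=> da p0 q0; rewrite /f_div_integrand.
have [->|p_neq0] := eqVneq.
  rewrite mulr0 subr0 (cvg_lim _ generator_recession)// mulrC EFinM.
  rewrite lee_wpmul2l ?lee_fin//.
  by apply: ereal_sup_ubound; exists a.
have {p_neq0}p0 : (0 < p)%R by rewrite lt_neqAle eq_sym p_neq0.
rewrite -lee_pdivrMl// -EFinM.
have -> : (p^-1 * (a * q - fs a * p) = a * (q / p) - fs a)%R.
  by field; rewrite gt_eqF.
exact: fenchel_young.
Qed.

Lemma f_div_integrand_lt p q r : (0 <= p)%R -> (0 <= q)%R ->
  r%:E < f_div_integrand f p q -> exists2 a, dom a & (r < a * q - fs a * p)%R.
Proof.
move=> p0 q0; rewrite /f_div_integrand.
have [->|p_neq0] := eqVneq.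
  rewrite (cvg_lim _ generator_recession)//.
  (* If [q = 0] too, the integrand is [0] even when the recession limit is [+oo], and any slope
     serves. *)
  move: q0; rewrite le_eqVlt => /predU1P[<-|q0].
    rewrite mul0e => r0; have [a da] := dom_fenchel_neq0.
    by exists a => //; rewrite !mulr0 subr0.
  rewrite -lte_pdivrMl// -EFinM => /ereal_sup_gt[_ [a da <-]].
  by rewrite lte_fin ltr_pdivrMl// mulrC => ra; exists a; rewrite ?mulr0 ?subr0.
have {p_neq0}p0 : (0 < p)%R by rewrite lt_neqAle eq_sym p_neq0.
rewrite -lte_pdivrMl// -EFinM => /fenchel_moreau[a da].
rewrite ltr_pdivrMl// => H; exists a => //; apply: lt_le_trans H _.
by rewrite le_eqVlt; apply/orP; left; apply/eqP; field; rewrite gt_eqF.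
Qed.

(** For fixed [p] and [q] the expression depends continuously on the pair [(a, f^*(a))], so a
    sequence dense in the graph of [f^*] suffices. One sequence serves all [p] and [q], which allows
    a measurable selection. *)
Lemma f_div_integrand_sup_sequence : exists2 s : nat -> R, forall i, dom (s i) &
  forall p q, (0 <= p)%R -> (0 <= q)%R ->
    f_div_integrand f p q =
    ereal_sup (range (fun i => (s i * q - fs (s i) * p)%:E)).
Proof.
have [s ds s_dense] := dense_sequence_graph fs dom_fenchel_neq0.
exists s => // p q p0 q0; apply/eqP; rewrite eq_le; apply/andP; split; last first.
  by apply: ge_ereal_sup => _ [i _ <-]; exact: f_div_integrand_young.
apply: lee_of_lt_EFin => r /(f_div_integrand_lt p0 q0)[a da ra].
(* The perturbation costs at most [e (p + q)], less than the gap above [r]; the added [1] keeps the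
   denominator positive. *)
pose e := ((a * q - fs a * p - r) / (p + q + 1))%R.
have e0 : (0 < e)%R by rewrite divr_gt0 ?subr_gt0//; lra.
have [i [si fi]] := s_dense a e da e0.
apply: (@le_trans _ _ (s i * q - fs (s i) * p)%:E); last first.
  by apply: ereal_sup_ubound; exists i.
have h1 : (`|s i - a| * q <= e * q)%R by rewrite ler_wpM2r// ltW.
have h2 : (`|fs (s i) - fs a| * p <= e * p)%R by rewrite ler_wpM2r// ltW.
have h3 : ((a - s i) * q <= `|s i - a| * q)%R.
  by rewrite ler_wpM2r// distrC ler_norm.
have h4 : ((fs (s i) - fs a) * p <= `|fs (s i) - fs a| * p)%R.
  by rewrite ler_wpM2r// ler_norm.
have h5 : (e * (p + q + 1) = a * q - fs a * p - r)%R.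
  by rewrite /e divfK// gt_eqF//; lra.
by rewrite lee_fin; lra.
Qed.

End fenchel.

(** * f-GANs *)

Lemma le_integral_measurable d (X : measurableType d) (R : realType)
    (mu : {measure set X -> \bar R}) (g h : X -> \bar R) :
    measurable_fun setT g -> measurable_fun setT h ->
  (forall x, g x <= h x)%E -> (\int[mu]_x g x <= \int[mu]_x h x)%E.
Proof.
move=> mg mh gh; rewrite [leLHS]integralE [leRHS]integralE.
apply: leeB; apply: ge0_le_integral => //.
- exact: measurable_funepos.
- exact: measurable_funepos.
- by move=> x _; apply: (@funepos_le _ _ setT) => //; rewrite inE.
- exact: measurable_funeneg.
- exact: measurable_funeneg.
- by move=> x _; apply: (@funeneg_le _ _ setT) => //; rewrite inE.
Qed.

(* Monotone convergence, with the nonnegativity of the sequence replaced by the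
   integrability of its first term. *)
Lemma integral_nondecreasing_limit_le d (X : measurableType d) (R : realType)
    (mu : {measure set X -> \bar R}) (h : nat -> X -> R) (g : X -> \bar R)
    (M : R) :
    (forall n, mu.-integrable setT (EFin \o h n)) ->
    (forall x, {homo h^~ x : m n / (m <= n)%N >-> m <= n}) ->
    (forall x, (h n x)%:E @[n --> \oo] --> g x) ->
    (forall n, (\int[mu]_x (h n x)%:E <= M%:E)%E) ->
  (\int[mu]_x g x <= M%:E)%E.
Proof.
move=> ih hh hg hM.
have mh n : measurable_fun setT (EFin \o h n) by exact: measurable_int (ih n).
have mg : measurable_fun setT g.
  by apply: (emeasurable_fun_cvg _ _ mh) => x _; exact: hg.
pose k n x := ((h n x)%:E - (h 0%N x)%:E)%E.
have mk n : measurable_fun setT (k n).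
  exact: (emeasurable_funB (mh n) (mh 0%N)).
have k0 n x : (0 <= k n x)%E by rewrite /k sube_ge0// lee_fin hh.
have ck x : k n x @[n --> \oo] --> (g x - (h 0%N x)%:E)%E.
  apply: cvgeB => //; first exact: fin_num_adde_defl.
  exact: cvg_cst.
have fin0 : (\int[mu]_x (h 0%N x)%:E)%E \is a fin_num.
  exact: (integrable_fin_num measurableT (ih 0%N)).
have lek : (\int[mu]_x (g x - (h 0%N x)%:E) <= M%:E - \int[mu]_x (h 0%N x)%:E)%E.
  have -> : (\int[mu]_x (g x - (h 0%N x)%:E) = limn (fun n => \int[mu]_x k n x))%E.
    rewrite -monotone_convergence//.
    - by apply: eq_integral => x _; apply/esym/cvg_lim => //; exact: ck.
    - by move=> x _ m n mn; rewrite /k leeB// lee_fin hh.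
  apply: lime_le.
    apply: ereal_nondecreasing_is_cvgn => m n mn; apply: ge0_le_integral => //.
    by move=> x _; rewrite /k leeB// lee_fin hh.
  apply: nearW => n; rewrite /k integralB//; [|exact: (ih n)|exact: (ih 0%N)].
  by rewrite leeB.
have gh0 x : (0 <= g x - (h 0%N x)%:E)%E.
  by apply: (cvge_ge _ (ck x)); apply: nearW => n; exact: k0.
(* The bound on its integral makes this nonnegative difference integrable, so the first term can be
   added back by linearity. *)
have ik : mu.-integrable setT (fun x => g x - (h 0%N x)%:E)%E.
  apply/integrableP; split.
    exact: (emeasurable_funB mg (mh 0%N)).
  under eq_integral do rewrite gee0_abs//.
  by apply: le_lt_trans lek _; rewrite -(fineK fin0) -EFinB ltry.
have -> : (\int[mu]_x g x = \int[mu]_x ((g x - (h 0%N x)%:E) + (h 0%N x)%:E))%E.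
  by apply: eq_integral => x _; rewrite subeK.
rewrite integralD//; last exact: (ih 0%N).
by rewrite -leeBrDr.
Qed.

(** The earliest index of a largest term among [u 0], ..., [u n]. Returning the index lets one
    choice act on the slopes and on their conjugate values alike. *)
Fixpoint prefix_argmax {R : realType} (u : nat -> R) (n : nat) : nat :=
  if n is m.+1 then
    let i := prefix_argmax u m in if u i < u m.+1 then m.+1 else i
  else 0%N.

Section prefix_argmax.
Context {R : realType}.
Implicit Type u : nat -> R.

Lemma prefix_argmax_le u n : (prefix_argmax u n <= n)%N.
Proof. by elim: n => //= n IH; case: ifPn => // _; exact: leqW. Qed.

Lemma prefix_argmax_homo u :
  {homo (fun n => u (prefix_argmax u n)) : m n / (m <= n)%N >-> m <= n}.
Proof.
apply/nondecreasing_seqP => n /=.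
by case: ifPn => [/ltW|].
Qed.

Lemma prefix_argmax_max u n : u n <= u (prefix_argmax u n).
Proof. by case: n => //= n; case: ifPn => //; rewrite -leNgt. Qed.

Lemma cvg_prefix_argmax u : (u (prefix_argmax u n))%:E @[n --> \oo] -->
  ereal_sup (range (EFin \o u)).
Proof.
have -> : ereal_sup (range (EFin \o u)) =
    ereal_sup (range (fun n => (u (prefix_argmax u n))%:E)).
  apply/eqP; rewrite eq_le; apply/andP; split; apply: ge_ereal_sup => _ [n _ <-].
    apply: (@le_trans _ _ (u (prefix_argmax u n))%:E).
      by rewrite lee_fin prefix_argmax_max.
    by apply: ereal_sup_ubound; exists n.
  by apply: ereal_sup_ubound; exists (prefix_argmax u n).
apply: ereal_nondecreasing_cvgn => m n mn.
by rewrite lee_fin; exact: prefix_argmax_homo.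
Qed.

(** The induction runs over all [v] at once, since the comparison in the recursive step uses the
    case [v = u]. *)
Lemma measurable_prefix_argmax d (X : measurableType d) (u v : nat -> X -> R) n :
    (forall i, measurable_fun setT (u i)) ->
    (forall i, measurable_fun setT (v i)) ->
  measurable_fun setT (fun x => v (prefix_argmax (u^~ x) n) x).
Proof.
move=> mu; elim: n v => [|n IH] v mv; first exact: mv.
rewrite [X in measurable_fun _ X](_ : _ = fun x =>
    if u (prefix_argmax (u^~ x) n) x < u n.+1 x then v n.+1 x
    else v (prefix_argmax (u^~ x) n) x); last first.
  by apply/funext => x /=; case: ifPn.
apply: measurable_fun_ifT => //; last exact: IH.
by apply: measurable_fun_ltr => //; exact: IH.
Qed.

(** Only the values [c 0], ..., [c n] occur, so the function is bounded, and [P] is finite. *)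
Lemma integrable_prefix_argmax d (X : measurableType d) (P : probability X R)
    (u : nat -> X -> R) (c : nat -> R) n :
    (forall i, measurable_fun setT (u i)) ->
  P.-integrable setT (EFin \o (fun x => c (prefix_argmax (u^~ x) n))).
Proof.
move=> mu; apply: measurable_bounded_integrable => //.
- by rewrite [X in (X < _)%E]probability_setT ltry.
- by apply: (@measurable_prefix_argmax _ _ u (fun i _ => c i)) => // i.
- exists (\sum_(i < n.+1) `|c i|); split; first exact: num_real.
  move=> M hM x _ /=; apply: le_trans (ltW hM).
  have in_ : (prefix_argmax (u^~ x) n < n.+1)%N by rewrite ltnS prefix_argmax_le.
  by rewrite (bigD1 (Ordinal in_))//= lerDl sumr_ge0.
Qed.

End prefix_argmax.

(** A supremum of affine functions is lower semicontinuous: a single competitor [t] stays above the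
    level on a neighbourhood. *)
Lemma measurable_fenchel_conjugate {R : realType} (f : R -> \bar R) :
  (forall t, (-oo < f t)%E) -> measurable_fun setT (fenchel_conjugate f).
Proof.
move=> fNy; apply: lower_semicontinuous_measurable => x a.
move=> /ereal_sup_gt[_ [t ft <-]].
have /fineK : f t \is a fin_num by rewrite fin_numElt fNy.
set v := fine _ => ftv; rewrite -ftv -EFinB lte_fin => axt.
exists [set y | a < y * t - v].
  have : y * t - v @[y --> x] --> x * t - v.
    by apply: cvgB; [apply: cvgM; [exact: cvg_id|exact: cvg_cst]|exact: cvg_cst].
  by move=> /cvgr_gt; apply.
move=> y /= ay; apply: (@lt_le_trans _ _ (y * t - v)%:E); first by rewrite lte_fin.
by apply: ereal_sup_ubound; exists t => //; rewrite -ftv mulrC.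
Qed.

Lemma measurable_fine_fenchel_conjugate d (X : measurableType d) (R : realType)
    (f : R -> \bar R) (D : X -> R) :
    (forall t, (-oo < f t)%E) -> measurable_fun setT D ->
  measurable_fun setT (fun x => fine (fenchel_conjugate f (D x))).
Proof.
move=> fNy mD.
apply: (@measurableT_comp _ _ _ _ _ _ (fine \o fenchel_conjugate f)) => //.
apply: measurableT_comp; first exact: fine_measurable.
exact: measurable_fenchel_conjugate.
Qed.

Lemma expectation_defined_integrable d (X : measurableType d) (R : realType)
    (P : probability X R) (g : X -> \bar R) :
  P.-integrable setT g -> expectation_defined P g.
Proof.
by move=> ig; split; [exact: measurable_int ig|exact: integrable_add_def].
Qed.

(** * The f-divergence as a supremum over discriminators *)

Section fgan_duality.
Local Open Scope ereal_scope.
Context d (X : measurableType d) (R : realType) (mu : {measure set X -> \bar R}).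
Context (P Q : probability X R) (p q : X -> R).
Hypotheses (hp : is_density mu P p) (hq : is_density mu Q q).
Context (f : R -> \bar R) (hf : f_divergence_generator f).

Let mp : measurable_fun setT p. Proof. by case: hp. Qed.
Let mq : measurable_fun setT q. Proof. by case: hq. Qed.
Let p0 x : (0 <= p x)%R. Proof. by case: hp. Qed.
Let q0 x : (0 <= q x)%R. Proof. by case: hq. Qed.
Local Notation dom := (effective_domain (fenchel_conjugate f)).
Local Notation fs := (fun a => fine (fenchel_conjugate f a)).

Lemma V_obj_FGAN_density (D : X -> R) :
    (forall x, dom (D x)) ->
    P.-integrable setT (EFin \o D) ->
    Q.-integrable setT (fun x => (fs (D x))%:E) ->
  mu.-integrable setT (fun x => (D x * p x - fs (D x) * q x)%:E) /\
  V_obj (FGAN X f) P Q D = \int[mu]_x (D x * p x - fs (D x) * q x)%:E.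
Proof.
move=> dD iD ifD.
have iDp := integrable_density hp iD.
have ifDq := integrable_density hq ifD.
split.
  rewrite (_ : (fun x => _) =
      (fun x => (D x * p x)%:E) \- (fun x => (fs (D x) * q x)%:E)).
    exact: integrableB.
  by apply/funext => x; rewrite EFinB.
have mD : measurable_fun setT D by apply/measurable_EFinP; exact: measurable_int iD.
have mfD : measurable_fun setT (fun x => fs (D x)).
  by apply/measurable_EFinP; exact: measurable_int ifD.
under [RHS]eq_integral do rewrite EFinB.
rewrite integralB// -(integral_density hp)// -(integral_density hq)//=.
by congr (_ - _); apply: eq_integral => x _; rewrite (fenchel_conjugateK hf).
Qed.

(** The integrand is the pointwise limit of the running maxima over the first slopes. *)
Lemma measurable_f_div_integrand :
  measurable_fun setT (fun x => f_div_integrand f (q x) (p x)).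
Proof.
have [s ds sE] := f_div_integrand_sup_sequence hf.
pose u i x := (s i * p x - fs (s i) * q x)%R.
have mu_ i : measurable_fun setT (u i).
  by apply: measurable_funB; apply: measurable_funM.
apply: (emeasurable_fun_cvg (fun n x => (u (prefix_argmax (u^~ x) n) x)%:E)).
  by move=> n; apply/measurable_EFinP; exact: measurable_prefix_argmax.
by move=> x _; rewrite sE//; exact: cvg_prefix_argmax.
Qed.

(** A finite objective forces both expectations to be finite, hence integrable; they then merge into
    one integral, compared pointwise by Fenchel-Young. *)
Lemma V_obj_FGAN_le (D : X -> R) (M : R) : admissible (FGAN X f) D ->
  V_obj (FGAN X f) P Q D = M%:E -> M%:E <= f_divergence mu f q p.
Proof.
move=> [mD dD] VM.
have mfD : measurable_fun setT (fun x => fs (D x)).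
  by apply: measurable_fine_fenchel_conjugate => //; case: hf.
have : V_obj (FGAN X f) P Q D \is a fin_num by rewrite VM.
rewrite /=; under [X in _ - X]eq_integral do rewrite (fenchel_conjugateK hf)//.
rewrite fin_numB => /andP[finD finfD].
have iD : P.-integrable setT (EFin \o D).
  by apply/integrableP; split; [exact/measurable_EFinP|rewrite integral_fin_num_abs].
have ifD : Q.-integrable setT (fun x => (fs (D x))%:E).
  by apply/integrableP; split; [exact/measurable_EFinP|rewrite integral_fin_num_abs].
have [i VE] := V_obj_FGAN_density dD iD ifD.
rewrite -VM VE; apply: le_integral_measurable.
- exact: measurable_int i.
- exact: measurable_f_div_integrand.
- by move=> x; exact: f_div_integrand_young.
Qed.

(** The selecting discriminators take finitely many values, so their objectives are defined and
    bounded by [M]; the bound survives the monotone limit. *)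
Lemma f_divergence_le (M : R) :
    (forall D, admissible (FGAN X f) D -> V_defined (FGAN X f) P Q D ->
      V_obj (FGAN X f) P Q D <= M%:E) ->
  f_divergence mu f q p <= M%:E.
Proof.
move=> VM; have [s ds sE] := f_div_integrand_sup_sequence hf.
pose u i x := (s i * p x - fs (s i) * q x)%R.
have mu_ i : measurable_fun setT (u i).
  by apply: measurable_funB; apply: measurable_funM.
pose D n x := s (prefix_argmax (u^~ x) n).
have mD n : measurable_fun setT (D n).
  by apply: (@measurable_prefix_argmax _ _ _ u (fun i _ => s i)) => // i.
have iD n : P.-integrable setT (EFin \o D n) by exact: integrable_prefix_argmax.
have ifD n : Q.-integrable setT (fun x => (fs (D n x))%:E).
  exact: (@integrable_prefix_argmax _ _ _ Q u (fun i => fs (s i))).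
have dD n x : dom (D n x) by exact: ds.
have VD n := V_obj_FGAN_density (dD n) (iD n) (ifD n).
apply: (@integral_nondecreasing_limit_le _ _ _ mu
  (fun n x => u (prefix_argmax (u^~ x) n) x)) => [n|x m n|x|n].
- by case: (VD n).
- exact: (@prefix_argmax_homo _ (u^~ x)).
- by rewrite sE//; exact: (@cvg_prefix_argmax _ (u^~ x)).
- case: (VD n) => _ <-; apply: VM; first by split.
  have fsE : (fun x => (fs (D n x))%:E) = fenchel_conjugate f \o D n.
    by apply/funext => x /=; rewrite -(fenchel_conjugateK hf).
  split; rewrite -?fsE; try exact: expectation_defined_integrable.
  apply: fin_num_adde_defr.
  exact: (integrable_fin_num measurableT (iD n)).
Qed.

End fgan_duality.

(** * Divergences against inner maxima, and the equilibrium argument *)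

Lemma DIV_eq_max_V_obj d (X : measurableType d) (R : realType)
    (mu : {measure set X -> \bar R}) (k : objective X R) (Pr : probability X R)
    (pr : X -> R) : objective_ok k -> is_density mu Pr pr ->
  exists c : R, forall (Pg : probability X R) (pg : X -> R) (D : X -> R) (M : R),
    is_density mu Pg pg -> admissible k D -> V_obj k Pr Pg D = M%:E ->
    M%:E = ereal_sup [set V_obj k Pr Pg D'
             | D' in [set D' | admissible k D' /\ V_defined k Pr Pg D']] ->
    DIV mu k Pg Pr pg pr = (c + M)%:E.
Proof.
case: k => [|c|f] hk hpr.
- exists (ln 2) => Pg pg D M hpg aD VM; rewrite EFinD => ->.
  rewrite /= (JSD_eq_sup_V_obj hpr hpg).
  (* [V_defined] is [True] for the classic objective, so both suprema range over the same
     discriminators. *)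
  by congr (_ + ereal_sup (_ @` _))%E; apply/seteqP; split => [D'|D' []].
- by exists 0 => Pg pg D M hpg aD VM MV; rewrite add0r MV.
- exists 0 => Pg pg D M hpg aD VM MV; rewrite add0r.
  (* The maximizer [D] has the finite objective [M], which gives [M <= D_f]; the converse bounds
     every defined objective by the supremum. *)
  apply/eqP; rewrite eq_le; apply/andP; split; last first.
    exact: (V_obj_FGAN_le hpr hpg hk aD VM).
  apply: (f_divergence_le hpr hpg hk) => D' aD' dD'; rewrite MV.
  by apply: ereal_sup_ubound; exists D'.
Qed.

Unset Implicit Arguments.
Set Strict Implicit.
Set Printing Implicit Defensive.

Theorem mainTheorem4 (R : realType) (d : measure_display) (X : measurableType d)
    (mu : {measure set X -> \bar R})
    (k : objective X R) (hk : objective_ok k)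
    (Pr : probability X R) (pr : X -> R) (hpr : is_density mu Pr pr)
    (TD TG : Type) (D : TD -> X -> R)
    (Pg : TG -> probability X R) (pg : TG -> X -> R)
    (hpg : forall tg, is_density mu (Pg tg) (pg tg))
    (hD : forall td, admissible k (D td))
    (hmax : forall tg, exists M : R,
      is_maximum (range (fun td => V_obj k Pr (Pg tg) (D td))) M%:E /\
      M%:E = ereal_sup [set V_obj k Pr (Pg tg) D'
                       | D' in [set D' | admissible k D' /\
                                         V_defined k Pr (Pg tg) D']])
    (E : set (X -> R)) (nrm : (X -> R) -> R) (hnrm : seminorm_on E nrm)
    (hDE : forall td, E (D td))
    (lambda : R) (hlambda : 0 <= lambda)
    (td0 : TD) (tg0 : TG)
    (heq : proximal_equilibrium D (fun td tg => V_obj k Pr (Pg tg) (D td))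
             nrm lambda td0 tg0) :
  is_minimum (range (fun tg => DIV mu k (Pg tg) Pr (pg tg) pr))
             (DIV mu k (Pg tg0) Pr (pg tg0) pr).
Proof.
have [c DIVE] := DIV_eq_max_V_obj hk hpr.
have div_max tg M : is_maximum (range (fun td => V_obj k Pr (Pg tg) (D td))) M%:E ->
    M%:E = ereal_sup [set V_obj k Pr (Pg tg) D'
             | D' in [set D' | admissible k D' /\ V_defined k Pr (Pg tg) D']] ->
    DIV mu k (Pg tg) Pr (pg tg) pr = (c + M)%:E.
  by move=> [[td _ Vtd] _]; exact: (DIVE _ _ (D td)).
have [M0 [max0 sup0]] := hmax tg0.
split; first by exists tg0.
move=> _ [tg _ <-]; have [M [maxM supM]] := hmax tg.
rewrite (div_max _ _ max0 sup0) (div_max _ _ maxM supM) lee_fin lerD2l -lee_fin.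
have [Vle /(_ tg)[m [[[td _ <-] _] V0m]]] := heq.
have [[[td1 _ Vtd1] _] [_ Mub]] := (max0, maxM).
(* With [td] attaining the penalized maximum at [tg], the chain is [M0 = V td1 tg0 <= V td0 tg0 <= V
   td tg - penalty <= V td tg <= M]. *)
rewrite -Vtd1 (le_trans (Vle td1))// (le_trans V0m)//.
apply: le_trans (Mub (V_obj k Pr (Pg tg) (D td)) _); last by exists td.
by rewrite leeBlDr// leeDl// lee_fin mulr_ge0// sqr_ge0.
Qed.
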